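(* Under the Qualification assumption, let $(m_1,w,m_2,D)\in\mathcal C$ and $(u,\gamma,P)\in\mathcal K$ be respectively solutions to $(\mathfrak P)$ and $(\mathfrak D)$. Let $\hat u=\mathbf U[\gamma,P]$ and let $\pi\in\boldsymbol{\pi}[m_1,w,\hat u,\gamma,P]$. Then $(m_1,\pi,\hat u,\gamma,P)$ is a solution to the mean field game system (MFG).
   Context: Let $T\ge 1$, $n\ge 1$ be integers, $\mathcal T=\{0,\dots,T-1\}$, $\bar{\mathcal T}=\{0,\dots,T\}$, $S=\{0,\dots,n-1\}$. For a finite set $A$, $\mathbb R(A)$ is the space of functions $A\to\mathbb R$ (Euclidean inner product and norm). $\Delta(S)=\{\rho:S\to[0,1]:\sum_{x}\rho(x)=1\}$, $\Delta=\{\pi:\mathcal T\times S\times S\to[0,1]:\pi(t,x,\cdot)\in\Delta(S)\ \forall(t,x)\}$. Spaces: $\mathcal R=\mathbb R(\bar{\mathcal T}\times S)\times\mathbb R(\mathcal T\times S^2)$, $\mathcal U=\mathbb R(\bar{\mathcal T}\times S)\times\mathbb R(\mathcal T)$, $\mathcal C=\mathcal R\times\mathbb R(\bar{\mathcal T}\times S)\times\mathbb R(\mathcal T)$, $\mathcal K=\mathbb R(\bar{\mathcal T}\times S)\times\mathcal U$. Data: $m_0\in\Delta(S)$, $\alpha:\mathcal T\times S^2\to\mathbb R$, $\ell:\mathcal T\times S\times\mathbb R(S)\to\mathbb R\cup\{+\infty\}$, $\phi:\mathcal T\times\mathbb R\to\mathbb R\cup\{+\infty\}$, $F:\bar{\mathcal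 T}\times\mathbb R(S)\to\mathbb R\cup\{+\infty\}$. Standing assumption: for all $(t,s,x)\in\mathcal T\times\bar{\mathcal T}\times S$ the functions $\ell(t,x,\cdot)$, $F(s,\cdot)$, $\phi(t,\cdot)$ are proper, convex and lower semicontinuous, and $\mathrm{dom}(\ell(t,x,\cdot))\subseteq\Delta(S)$. Fenchel conjugates and subdifferentials of $\ell,F,\phi$ are in the last variable. System (MFG), for $(m,\pi,u,\gamma,P)\in\mathcal R\times\mathcal K$ and all $(t,s,x)\in\mathcal T\times\bar{\mathcal T}\times S$: (i) $u(t,x)=\inf_{\rho\in\Delta(S)}\big[\ell(t,x,\rho)+\gamma(t,x)+\sum_{y\in S}\rho(y)(\alpha(t,x,y)P(t)+u(t+1,y))\big]$, $u(T,x)=\gamma(T,x)$; (ii) $\pi(t,x,\cdot)\in\Delta(S)$ attains the infimum in (i); (iii) $m(t+1,x)=\sum_{y\in S}m(t,y)\pi(t,y,x)$, $m(0,x)=m_0(x)$; (iv) $\gamma(s,\cdot)\in\partial F(s,m(s,\cdot))$; (v) $P(t)\in\partial\phi\big(t,\sum_{(x,y)\in S^2}m(t,x)\pi(t,x,y)\alpha(t,x,y)\big)$. Operators: $\mathbf A[w](t)=\sum_{(x,y)\in S^2}w(t,x,y)\alpha(t,x,y)$; $\mathbf S[w](s,x)=\sum_{y\in S}w(s-1,y,x)$ if $s>0$, and $\mathbf S[w](0,x)=0$. $\bar m_0(0,x)=m_0(x)$, $\bar m_0(s,x)=0$ for $s>0$. Perspective: $\tilde\ell(t,x,\theta,z)=\theta\,\ell(t,x,z/\theta)$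 if $\theta>0$; $=0$ if $(\theta,z)=(0,0)$; $=+\infty$ otherwise. Problem $(\mathfrak P)$: $\inf_{\mathcal C}\mathcal F(m_1,w,m_2,D)+\mathcal G(\mathcal A(m_1,w,m_2,D))$, where $\mathcal F(m_1,w,m_2,D)=\sum_{(t,x)\in\mathcal T\times S}\tilde\ell(t,x,m_1(t,x),w(t,x,\cdot))+\sum_{t\in\mathcal T}\phi(t,D(t))+\sum_{s\in\bar{\mathcal T}}F(s,m_2(s,\cdot))$; $\mathcal G(y_1,y_2,y_3)=0$ if $y_1=-\bar m_0$, $y_2=0$, $y_3=0$ and $+\infty$ otherwise on $\mathcal K$; $\mathcal A(m_1,w,m_2,D)=(\mathbf S w-m_1,m_1-m_2,\mathbf A w-D)$. Problem $(\mathfrak D)$: $\inf_{(u,\gamma,P)\in\mathcal K}\mathcal F^\star(-\mathcal A^\star(u,\gamma,P))+\mathcal G^\star(u,\gamma,P)$, with Fenchel conjugates and adjoint. $\mathbf U[\gamma,P]$ is the solution $u\in\mathbb R(\bar{\mathcal T}\times S)$ of $u(t,x)+\ell^\star(t,x,-\alpha(t,x,\cdot)P(t)-u(t+1,\cdot))=\gamma(t,x)$ on $\mathcal T\times S$, $u(T,\cdot)=\gamma(T,\cdot)$. For $(m,w)\in\mathcal R$, $(u,\gamma,P)\in\mathcal K$, $\boldsymbol{\pi}[m,w,u,\gamma,P]$ is the set of $\pi\in\Delta$ such that for all $(t,x)\in\mathcal T\times S$: $\pi(t,x,\cdot)=w(t,x,\cdot)/m(t,x)$ if $m(t,x)>0$,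 and $\pi(t,x,\cdot)\in\arg\min_{\rho\in\Delta(S)}\ \ell(t,x,\rho)+\sum_{y\in S}\rho(y)(P(t)\alpha(t,x,y)+u(t+1,y))$ if $m(t,x)=0$. Qualification assumption: there exists $\alpha_0>0$ such that for every $\varepsilon=(\varepsilon_1,\varepsilon_2,\varepsilon_3)\in\mathcal K$ with $\|\varepsilon\|\le\alpha_0$ there exists $\pi:\mathcal T\times S\times S\to\mathbb R$ with $\pi(t,x,\cdot)\in\mathrm{dom}(\ell(t,x,\cdot))$ for all $(t,x)$ such that $m_1[\varepsilon,\pi]\ge0$, $m_2[\varepsilon,\pi](s,\cdot)\in\mathrm{dom}(F(s,\cdot))$ for all $s\in\bar{\mathcal T}$, and $D[\varepsilon,\pi](t)\in\mathrm{dom}(\phi(t,\cdot))$ for all $t\in\mathcal T$. Here $m_1=m_1[\varepsilon,\pi]$ solves $m_1(0,x)-\varepsilon_1(0,x)=m_0(x)$, $m_1(t+1,x)=\sum_{y\in S}m_1(t,y)\pi(t,y,x)-\varepsilon_1(t+1,x)$; $m_2[\varepsilon,\pi]=m_1[\varepsilon,\pi]+\varepsilon_2$; $D[\varepsilon,\pi](t)=\sum_{(x,y)\in S^2}m_1[\varepsilon,\pi](t,x)\pi(t,x,y)\alpha(t,x,y)+\varepsilon_3(t)$. *)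

(* Defs.v *)
From mathcomp Require Import all_boot all_order all_algebra.
From mathcomp Require Import all_classical all_reals all_analysis.
From mathcomp Require Import lra.
Set Implicit Arguments.
Unset Strict Implicit.
Unset Printing Implicit Defensive.
Import Order.TTheory GRing.Theory Num.Theory numFieldNormedType.Exports.
Local Open Scope classical_set_scope.
Local Open Scope ring_scope.

(* Time t of the set {0, ..., T-1} seen in {0, ..., T}, and its successor. *)
Notation tnow t := (widen_ord (leqnSn _) t).
Notation tnext t := (lift ord0 t).

(* Function spaces, with S = 'I_n: a function of (s, x), s = 0..T, is a matrix
   with rows indexed by s; a function of (t, x, y), t = 0..T-1, is a family of
   square matrices, [w t x y] being its value; a function of t is a row. *)
Notation flow R T n := 'M[R]_(T.+1, n).
Notation kern R T n := ('I_T -> 'M[R]_n).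
Notation price R T := 'rV[R]_T.
Notation Cspace R T n := (flow R T n * kern R T n * flow R T n * price R T)%type.
Notation Kspace R T n := (flow R T n * flow R T n * price R T)%type.

Section convex_analysis.
Variable R : realType.
Implicit Types (X Y : zmodType).

Definition effdom (X : Type) (f : X -> \bar R) : set X := [set x | f x < +oo]%E.

Definition proper_fun (X : Type) (f : X -> \bar R) : Prop :=
  (forall x, f x != -oo%E) /\ effdom f !=set0.

(* With 0 * +oo = 0, the cases t = 0 and t = 1 are harmless. *)
Definition convex_efun (X : lmodType R) (f : X -> \bar R) : Prop :=
  forall (x y : X) (t : R), 0 <= t <= 1 ->
    (f (t *: x + (1 - t) *: y)%R <= t%:E * f x + (1 - t)%:E * f y)%E.

Definition conjugate (X : Type) (ip : X -> X -> R) (f : X -> \bar R) (y : X) :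
    \bar R :=
  ereal_sup [set ((ip y x)%:E - f x)%E | x in [set: X]].

Definition subdiff X (ip : X -> X -> R) (f : X -> \bar R) (x : X) : set X :=
  [set g | forall y, (f x + (ip g (y - x)%R)%:E <= f y)%E].

Definition argmin (X : Type) (A : set X) (f : X -> \bar R) : set X :=
  [set x | A x /\ f x = ereal_inf (f @` A)].

(* The adjoint is chosen among the solutions of its defining equation; see
   [calA_adjE] for the operator to which it is applied. *)
Definition adjoint X Y (ipX : X -> X -> R) (ipY : Y -> Y -> R) (L : X -> Y)
    (y : Y) : X :=
  xget 0 [set x' | forall x, ipY (L x) y = ipX x x'].

Definition perspective (X : lmodType R) (f : X -> \bar R) (theta : R) (z : X) :
    \bar R :=
  if 0 < theta then (theta%:E * f (theta^-1 *: z)%R)%E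
  else if (theta == 0) && (z == 0) then 0%E else +oo%E.

Definition dot p q (a b : 'M[R]_(p, q)) : R := \sum_i \sum_j a i j * b i j.

Definition dot_kern T n (v w : kern R T n) : R := \sum_t dot (v t) (w t).

Definition dotC T n (a b : Cspace R T n) : R :=
  let: (m1, w, m2, D) := a in let: (m1', w', m2', D') := b in
  dot m1 m1' + dot_kern w w' + dot m2 m2' + dot D D'.

Definition dotK T n (a b : Kspace R T n) : R :=
  let: (y1, y2, y3) := a in let: (y1', y2', y3') := b in
  dot y1 y1' + dot y2 y2' + dot y3 y3'.

Definition normK T n (a : Kspace R T n) : R := Num.sqrt (dotK a a).

Definition simplex n : set 'rV[R]_n :=
  [set rho | (forall x, 0 <= rho ord0 x <= 1) /\ \sum_x rho ord0 x = 1].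

End convex_analysis.

Record mfg_data (R : realType) (T n : nat) := MfgData {
  mfg_m0 : 'rV[R]_n;
  mfg_alpha : kern R T n;
  mfg_ell : 'I_T -> 'I_n -> 'rV[R]_n -> \bar R;
  mfg_phi : 'I_T -> R -> \bar R;
  mfg_F : 'I_T.+1 -> 'rV[R]_n -> \bar R
}.

Section mean_field_game.
Variables (R : realType) (T n : nat) (d : mfg_data R T n).
Implicit Types (m u gamma : flow R T n) (w pi : kern R T n) (P D : price R T).

Local Notation m0 := (mfg_m0 d).
Local Notation alpha := (mfg_alpha d).
Local Notation ell := (mfg_ell d).
Local Notation phi := (mfg_phi d).
Local Notation F := (mfg_F d).

Definition standing_assumption : Prop :=
  [/\ simplex m0,
      forall t x, [/\ proper_fun (ell t x), convex_efun (ell t x),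
        lower_semicontinuous (ell t x) & effdom (ell t x) `<=` @simplex R n],
      forall s, [/\ proper_fun (F s), convex_efun (F s)
        & lower_semicontinuous (F s)]
    & forall t, [/\ proper_fun (phi t), @convex_efun R R^o (phi t)
        & lower_semicontinuous (phi t)]].

Definition opA w : price R T := \row_t \sum_x \sum_y w t x y * alpha t x y.

Definition opS w : flow R T n :=
  \matrix_(s, x) if unlift ord0 s is Some t then \sum_y w t y x else 0.

Definition bar_m0 : flow R T n :=
  \matrix_(s, x) if s == ord0 then m0 ord0 x else 0.

Definition is_policy pi : Prop := forall t x, simplex (row x (pi t)).

(* rho |-> ell(t,x,rho) + sum_y rho(y) (alpha(t,x,y) P(t) + u(t+1,y)) *)
Definition bellman u P (t : 'I_T) (x : 'I_n) (rho : 'rV[R]_n) : \bar R :=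
  (ell t x rho +
   (\sum_y rho ord0 y * (alpha t x y * P ord0 t + u (tnext t) y))%:E)%E.

Definition mfg_system m pi u gamma P : Prop :=
  [/\ (forall t x, (u (tnow t) x)%:E = ereal_inf
          [set (bellman u P t x rho + (gamma (tnow t) x)%:E)%E
             | rho in @simplex R n]) /\
        (forall x, u ord_max x = gamma ord_max x),
      forall t x, argmin (@simplex R n)
          (fun rho => bellman u P t x rho + (gamma (tnow t) x)%:E)%E
          (row x (pi t)),
      (forall (t : 'I_T) x, m (tnext t) x = \sum_y m (tnow t) y * pi t y x) /\
        (forall x, m ord0 x = m0 ord0 x),
      forall s, subdiff (@dot R 1 n) (F s) (row s m) (row s gamma)
    & forall t, subdiff (fun a b : R => a * b) (phi t)
          (\sum_x \sum_y m (tnow t) x * pi t x y * alpha t x y) (P ord0 t)].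

Definition calF (c : Cspace R T n) : \bar R :=
  let: (m1, w, m2, D) := c in
  ((\sum_t \sum_x perspective (ell t x) (m1 (tnow t) x) (row x (w t))) +
   (\sum_t phi t (D ord0 t)) + \sum_s F s (row s m2))%E.

Definition calG (k : Kspace R T n) : \bar R :=
  if k == (- bar_m0, 0, 0) then 0%E else +oo%E.

Definition calA (c : Cspace R T n) : Kspace R T n :=
  let: (m1, w, m2, D) := c in (opS w - m1, m1 - m2, opA w - D).

Definition calA_adj : Kspace R T n -> Cspace R T n :=
  adjoint (@dotC R T n) (@dotK R T n) calA.

Definition primal_obj (c : Cspace R T n) : \bar R := (calF c + calG (calA c))%E.

Definition dual_obj (k : Kspace R T n) : \bar R :=
  (conjugate (@dotC R T n) calF (- calA_adj k)%R +
   conjugate (@dotK R T n) calG k)%E.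

Definition primal_solution (c : Cspace R T n) : Prop := argmin setT primal_obj c.

Definition dual_solution (k : Kspace R T n) : Prop := argmin setT dual_obj k.

Definition hjb gamma P u : Prop :=
  (forall t x, ((u (tnow t) x)%:E + conjugate (@dot R 1 n) (ell t x)
       (\row_y (- alpha t x y * P ord0 t - u (tnext t) y))%R =
     (gamma (tnow t) x)%:E)%E) /\
  (forall x, u ord_max x = gamma ord_max x).

(* Existence and uniqueness: [opU_hjb] and [hjb_unique]. *)
Definition opU gamma P : flow R T n := xget 0 (hjb gamma P).

Definition policies m w u P : set (kern R T n) :=
  [set pi | is_policy pi /\ forall t x,
     (0 < m (tnow t) x ->
        row x (pi t) = (m (tnow t) x)^-1 *: row x (w t)) /\
     (m (tnow t) x = 0 -> argmin (@simplex R n) (bellman u P t x) (row x (pi t)))].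

Definition perturbed_flow (e1 : flow R T n) pi m : Prop :=
  (forall x, m ord0 x - e1 ord0 x = m0 ord0 x) /\
  (forall (t : 'I_T) x,
     m (tnext t) x = (\sum_y m (tnow t) y * pi t y x) - e1 (tnext t) x).

(* The flow m1[e, pi] is the only one satisfying [perturbed_flow]. *)
Definition qualification : Prop :=
  exists2 a0 : R, 0 < a0 & forall (e1 e2 : flow R T n) (e3 : price R T),
    normK (e1, e2, e3) <= a0 ->
    exists pi m1, let m2 := m1 + e2 in
      [/\ (forall t x, effdom (ell t x) (row x (pi t))),
          perturbed_flow e1 pi m1,
          (forall s x, 0 <= m1 s x),
          (forall s, effdom (F s) (row s m2))
        & (forall t, effdom (phi t)
            ((\sum_x \sum_y m1 (tnow t) x * pi t x y * alpha t x y)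
             + e3 ord0 t))].

Definition calA_adj_formula (k : Kspace R T n) : Cspace R T n :=
  let: (u, gamma, P) := k in
  (gamma - u,
   fun t => \matrix_(x, y) (u (tnext t) y + alpha t x y * P ord0 t),
   - gamma, - P).

Lemma dotDl p q (a b c : 'M[R]_(p, q)) : dot (a + b) c = dot a c + dot b c.
Proof.
rewrite /dot -big_split; apply: eq_bigr => i _ /=; rewrite -big_split.
by apply: eq_bigr => j _; rewrite mxE mulrDl.
Qed.

Lemma dotC_sym p q (a b : 'M[R]_(p, q)) : dot a b = dot b a.
Proof. by apply: eq_bigr => i _; apply: eq_bigr => j _; rewrite mulrC. Qed.

Lemma dotNl p q (a c : 'M[R]_(p, q)) : dot (- a) c = - dot a c.
Proof.
rewrite /dot -sumrN; apply: eq_bigr => i _ /=; rewrite -sumrN.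
by apply: eq_bigr => j _; rewrite mxE mulNr.
Qed.

Lemma dotDr p q (a b c : 'M[R]_(p, q)) : dot c (a + b) = dot c a + dot c b.
Proof. by rewrite ![dot c _]dotC_sym dotDl. Qed.

Lemma dotNr p q (a c : 'M[R]_(p, q)) : dot c (- a) = - dot c a.
Proof. by rewrite ![dot c _]dotC_sym dotNl. Qed.

Lemma dot_eq0 p q (a : 'M[R]_(p, q)) : dot a a = 0 -> a = 0.
Proof.
move=> a0; apply/matrixP => i j; rewrite mxE.
have h k : 0 <= \sum_l a k l * a k l.
  by apply: sumr_ge0 => l _; rewrite -expr2 sqr_ge0.
have e := psumr_eq0P (fun k _ => h k) a0 (i := i) isT.
apply/eqP; rewrite -sqrf_eq0 expr2; apply/eqP.
by apply: (psumr_eq0P (P := xpredT) _ e) => // l _; rewrite -expr2 sqr_ge0.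
Qed.

Lemma calA_adj_formulaP (c : Cspace R T n) (k : Kspace R T n) :
  dotK (calA c) k = dotC c (calA_adj_formula k).
Proof.
case: c => [[[m w] m2] D]; case: k => [[u gamma] P] /=.
have -> : dot_kern w
    (fun t => \matrix_(x, y) (u (tnext t) y + alpha t x y * P ord0 t)) =
    dot (opS w) u + dot (opA w) P.
  have -> : dot (opS w) u = \sum_t \sum_x \sum_y w t x y * u (tnext t) y.
    rewrite /dot big_ord_recl big1 ?add0r => [|x _]; last first.
      by rewrite /opS mxE unlift_none mul0r.
    apply: eq_bigr => t _; rewrite exchange_big; apply: eq_bigr => y _ /=.
    by rewrite /opS mxE liftK mulr_suml.
  have -> : dot (opA w) P =
      \sum_t \sum_x \sum_y w t x y * (alpha t x y * P ord0 t).
    rewrite /dot big_ord1; apply: eq_bigr => t _.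
    rewrite /opA mxE mulr_suml; apply: eq_bigr => x _.
    by rewrite mulr_suml; apply: eq_bigr => y _; rewrite mulrA.
  rewrite -big_split; apply: eq_bigr => t _ /=.
  rewrite -big_split; apply: eq_bigr => x _ /=.
  rewrite -big_split; apply: eq_bigr => y _ /=.
  by rewrite mxE mulrDr.
rewrite !dotDl !dotNl !dotDr !dotNr; lra.
Qed.

Lemma calA_adjE k : calA_adj k = calA_adj_formula k.
Proof.
rewrite /calA_adj /adjoint; case: xgetP => [x' _ hx'|]; last first.
  by move=> /(_ (calA_adj_formula k))[] c; exact: calA_adj_formulaP.
have {hx'}h c : dotC c x' = dotC c (calA_adj_formula k).
  by rewrite -hx' calA_adj_formulaP.
case: x' (calA_adj_formula k) h => [[[m w] m2] D] [[[m' w'] m2'] D'] h.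
have d0 p q (b : 'M[R]_(p, q)) : dot 0 b = 0.
  by apply: big1 => i _; apply: big1 => j _; rewrite mxE mul0r.
have dk0 (b : kern R T n) : dot_kern (0 : kern R T n) b = 0.
  by apply: big1 => t _; exact: d0.
have dB p q (a b : 'M[R]_(p, q)) : dot (a - b) a = dot (a - b) b -> a = b.
  move=> e; apply/eqP; rewrite -subr_eq0; apply/eqP/dot_eq0.
  by rewrite dotDr dotNr e subrr.
congr (_, _, _, _).
- by apply: dB; have := h (m - m', 0, 0, 0); rewrite /= !d0 !dk0 !addr0.
- apply/funext => t; apply: dB.
  have := h (0, fun s => if s == t then w t - w' t else 0, 0, 0).
  rewrite /= !d0 /dot_kern (bigD1 t)//= eqxx big1 => [|s /negPf->]; last exact: d0.
  rewrite (bigD1 t)//= eqxx big1 => [|s /negPf->]; last exact: d0.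
  by rewrite !addr0 !add0r.
- by apply: dB; have := h (0, 0, m2 - m2', 0); rewrite /= !d0 !dk0 !addr0 !add0r.
- by apply: dB; have := h (0, 0, 0, D - D'); rewrite /= !d0 !dk0 !add0r.
Qed.

Lemma hjb_unique gamma P u u' : hjb gamma P u -> hjb gamma P u' -> u = u'.
Proof.
move=> [hu hT] [hu' hT'].
suff H k : forall s : 'I_T.+1, (T - k <= s)%N -> row s u = row s u'.
  by apply/row_matrixP => s; apply: (H T); rewrite subnn.
elim: k => [|k IH] s hs.
  have -> : s = ord_max.
    by apply/val_inj/eqP; rewrite /= eqn_leq -ltnS ltn_ord -[X in (X <= _)%N]subn0.
  by apply/rowP => x; rewrite !mxE hT hT'.
have [/IH//|lts] := leqP (T - k) s.
have ltsT : (s < T)%N by apply: leq_trans lts _; exact: leq_subr.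
pose t := Ordinal ltsT.
have -> : s = tnow t by exact: val_inj.
have e : row (tnext t) u = row (tnext t) u' 
    by apply: IH; rewrite lift0 /=; move: hs; rewrite subnS; case: (T - k)%N.
have {}e y : u (tnext t) y = u' (tnext t) y.
  by have /rowP/(_ y) := e; rewrite !mxE.
apply/rowP => x; rewrite !mxE; have := hu t x; rewrite -(hu' t x).
under eq_mx do rewrite e.
set c := conjugate _ _ _ => E.
have cf : c \is a fin_num.
  by have := hu' t x; rewrite -/c; case: (c).
by move: E; rewrite -(fineK cf) -!EFinD => -[] /addIr.
Qed.

Lemma ell_bounded_below : standing_assumption -> forall t x,
  exists c : R, forall rho, (c%:E <= ell t x rho)%E.
Proof.
move=> [_ hell _ _] t x; have [[hNy _] _ hlsc hdom] := hell t x.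
pose box := [set v : 'rV[R]_n | forall i, `[0, 1]%classic (v ord0 i)].
have cbox : compact box.
  by apply: (@rV_compact R n (fun=> `[0, 1]%classic)) => i; exact: segment_compact.
have /compact_near_coveringP := cbox.
move=> /(_ nat \oo (fun k rho => (- k%:R)%:E < ell t x rho)%E _).
case => [rho _|N _ hN].
  have [a ha] : exists a : R, (a%:E < ell t x rho)%E.
    have := hNy rho; case: (ell t x rho) => [r| |]// _.
      by exists (r - 1); rewrite lte_fin ltrBlDr ltrDl.
    by exists 0; rewrite ltry.
  have [V hV hVa] := hlsc _ _ ha.
  exists (V, [set k | (Num.truncn `|a| < k)%N]) => /=.
    by split => //; exists (Num.truncn `|a|).+1.
  case=> r k /= [Vr hk]; apply: le_lt_trans (hVa _ Vr).
  rewrite lee_fin lerNl; apply: le_trans (ler_norm _) _; rewrite normrN.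
  apply: ltW; apply: lt_le_trans (truncnS_gt _) _.
  by rewrite ler_nat.
exists (- N%:R) => rho.
have [->|neq] := eqVneq (ell t x rho) +oo%E; first by rewrite leey.
apply/ltW/(hN N) => /=; first exact: leqnn.
move=> i; rewrite /= in_itv /=.
by have [] := hdom rho; rewrite /effdom /= ?ltey.
Qed.

Lemma conjugate_ell_fin : standing_assumption -> forall t x y,
  conjugate (@dot R 1 n) (ell t x) y \is a fin_num.
Proof.
move=> hstd t x y; have [c hc] := ell_bounded_below hstd t x.
have [_ /(_ t x) [[hNy [r0 hr0]] _ _ hdom] _ _] := hstd.
rewrite fin_real//; apply/andP; split.
  have : ((dot y r0)%:E - ell t x r0 <= conjugate (@dot R 1 n) (ell t x) y)%E.
    by apply: ereal_sup_ubound; exists r0.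
  apply: lt_le_trans.
  have := hNy r0; move: hr0; rewrite /effdom /=.
  by case: (ell t x r0) => // r _ _; rewrite -EFinB ltNyr.
apply: (@le_lt_trans _ _ ((\sum_i `|y ord0 i|) - c)%:E); last exact: ltry.
apply: ge_ereal_sup => _ [rho _ <-].
have [->|neq] := eqVneq (ell t x rho) +oo%E; first by rewrite leNye.
have [hrho _] : simplex rho by apply: hdom; rewrite /effdom /= ltey.
rewrite EFinB; apply: leeB => //.
rewrite lee_fin /dot big_ord1; apply: ler_sum => i _.
have /andP[r_ge0 r_le1] := hrho i.
apply: le_trans (ler_norm _) _; rewrite normrM (ger0_norm r_ge0).
by rewrite -[leRHS]mulr1 ler_wpM2l.
Qed.

Lemma hjb_exists : standing_assumption -> forall gamma P,
  exists u, hjb gamma P u.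
Proof.
move=> hstd gamma P.
pose c u t x := conjugate (@dot R 1 n) (ell t x)
  (\row_y (- alpha t x y * P ord0 t - u (tnext t) y)).
suff H k : exists u : flow R T n,
    (forall x, u ord_max x = gamma ord_max x) /\
    (forall (t : 'I_T) x, (T - k <= t)%N ->
       ((u (tnow t) x)%:E + c u t x = (gamma (tnow t) x)%:E)%E).
  have [u [h1 h2]] := H T; exists u; split => // t x.
  by apply: h2; rewrite subnn.
elim: k => [|k [u [h1 h2]]].
  exists gamma; split => // t x; rewrite subn0 leqNgt.
  by rewrite ltn_ord.
have [leTk|ltkT] := leqP T k.
  exists u; split => // t x _; apply: h2.
  by move: leTk; rewrite -subn_eq0 => /eqP->.
pose u' : flow R T n := \matrix_(s, x)
  if insub (s : nat) : option 'I_T is Some t then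
    if t == (T - k.+1)%N :> nat then gamma s x - fine (c u t x) else u s x
  else u s x.
have u'E (s : 'I_T.+1) x : (T - k.+1 < s)%N -> u' s x = u s x.
  move=> lts; rewrite /u' mxE; case: insubP => // t _ ets.
  by case: eqP => // ets'; rewrite -ets -ets' ltnn in lts.
have cE (t : 'I_T) x : (T - k.+1 <= t)%N -> c u' t x = c u t x.
  move=> let_; rewrite /c; congr (conjugate _ _ _); apply/rowP => y.
  by rewrite mxE [RHS]mxE u'E// lift0 ltnS.
exists u'; split => [x|t x let_].
  by rewrite u'E// ltn_subrL (leq_ltn_trans _ ltkT).
rewrite cE//.
have [et|net] := eqVneq (t : nat) (T - k.+1)%N.
  rewrite /u' mxE /=; case: insubP => [t' _ et'|]; last by rewrite ltn_ord.
  have -> : t' = t by exact: val_inj.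
  rewrite et eqxx EFinB fineK; last exact: conjugate_ell_fin.
  by rewrite subeK//; exact: conjugate_ell_fin.
have ltt : (T - k.+1 < t)%N by rewrite ltn_neqAle eq_sym net.
rewrite u'E//; apply: h2.
by rewrite subnS in ltt; move: ltt; rewrite prednK// subn_gt0.
Qed.

Lemma opU_hjb : standing_assumption -> forall gamma P, hjb gamma P (opU gamma P).
Proof.
move=> hstd gamma P; rewrite /opU; case: xgetP => // h.
by have [u hu] := hjb_exists hstd gamma P; case: (h u).
Qed.

End mean_field_game.

(* Main.v *)
Require Import Defs.
From mathcomp Require Import all_boot all_order all_algebra.
From mathcomp Require Import all_classical all_reals all_analysis.
From mathcomp Require Import ring lra.
Set Implicit Arguments.
Unset Strict Implicit.
Unset Printing Implicit Defensive.
Import Order.TTheory GRing.Theory Num.Theory numFieldNormedType.Exports.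
Local Open Scope classical_set_scope.
Local Open Scope ring_scope.

(** The pair of problems is a Fenchel-Rockafellar pair, and the mean field game
    system is the first-order optimality condition of the primal problem at a
    multiplier [(u, gamma, P)], once [u] is replaced by the value function.

    Strong duality. The constraint [calA c = target] is affine, [calF] is convex
    and the qualification assumption says that every small perturbation of the
    target is reached at finite cost. Then the primal value [v] has a Lagrange
    multiplier ([lagrange_multipliers], a finite-dimensional Hahn-Banach argument
    adding one scalar constraint at a time), so the dual value is at most [-v],
    and every dual solution [k] satisfies, for all [c],
      [v <= calF c + dotK (calA c - target) k]
    ([dual_solution_lagrangian]). At a primal solution this says that minus the
    adjoint of [k] is a subgradient of [calF].

    Separation. [calF] is a sum of functions of disjoint blocks of variables, so
    moving one block at a time splits the subgradient into one condition per
    block: the conditions on [F] and [phi] of the system; [u(T) = gamma(T)];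
    and, for each [(t, x)], a subgradient of the perspective of [ell]. As the
    latter is positively homogeneous, its value at the optimum is
    [- edge_cost u], and [0 <= perspective + edge_cost u] everywhere: [u] is a
    subsolution of the dynamic programming equation that is tight on the optimal
    flow.

    From [u] to the value function. The solution [uhat] of the equation is also
    feasible, and [u <= uhat] by backward comparison. Summed along the optimal
    flow, the edge costs telescope to a constant minus the integral of [u(0)]
    against the initial distribution, so the inequality [u <= uhat] can only
    decrease the total slack; being a sum of nonnegative terms starting from
    zero, it stays zero term by term ([tight_transfer]). Where the mass is
    positive, tightness for [uhat] says that [w / m1] attains the minimum in the
    Bellman equation; where it vanishes, [pi] is a minimizer by definition. *)

(** * Lagrange multipliers for finitely many affine constraints *)

Section lagrange_multipliers.
Variables (R : realType) (X : lmodType R).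
Implicit Types (C : set X) (g h : X -> R).

(** Convexity in terms of real weights, as in [convex_efun]. *)
Definition segment_closed C : Prop := forall x y t, C x -> C y -> 0 <= t <= 1 ->
  C (t *: x + (1 - t) *: y).

Definition affine_fun h : Prop := forall x y t,
  h (t *: x + (1 - t) *: y) = t * h x + (1 - t) * h y.

(** The points with [0 < h] bound the multiplier from below, those with [h < 0]
    from above; the chord joining two such points crosses [h = 0], which makes
    the bounds compatible. *)
Lemma lagrange_multiplier1 C g h (v : R) :
  segment_closed C -> affine_fun g -> affine_fun h ->
  (forall x, C x -> h x = 0 -> v <= g x) ->
  (exists2 x, C x & 0 < h x) -> (exists2 x, C x & h x < 0) ->
  exists a, forall x, C x -> v <= g x + a * h x.
Proof.
move=> Cconv gaff haff vmin [p Cp hp] [q Cq hq].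
(* Where the chord from y to x crosses h = 0, the value of g is at least v. *)
have slopes x y : C x -> C y -> 0 < h x -> h y < 0 ->
    (v - g x) / h x <= (v - g y) / h y.
  move=> Cx Cy hx hy.
  have hxy : 0 < h x - h y by lra.
  pose t := - h y / (h x - h y).
  have t1 : 1 - t = h x / (h x - h y) by rewrite /t; field; lra.
  have t01 : 0 <= t <= 1.
    apply/andP; split; first by rewrite divr_ge0; lra.
    by rewrite -subr_ge0 t1 divr_ge0; lra.
  have := vmin _ (Cconv _ _ _ Cx Cy t01); rewrite gaff haff t1.
  have -> : t * h x + h x / (h x - h y) * h y = 0 by rewrite /t; field; lra.
  move=> /(_ erefl).
  have -> : t * g x + h x / (h x - h y) * g y =
      (h x * g y - h y * g x) / (h x - h y) by rewrite /t; field; lra.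
  rewrite ler_pdivlMr // => le_v.
  rewrite -subr_ge0.
  have -> : (v - g y) / h y - (v - g x) / h x =
      (h x * g y - h y * g x - v * (h x - h y)) / (h x * - h y).
    by field; apply/andP; split; lra.
  by rewrite divr_ge0 ?mulr_ge0; lra.
pose A := [set (v - g x) / h x | x in [set x | C x /\ 0 < h x]].
have ubA y : C y -> h y < 0 -> ubound A ((v - g y) / h y).
  by move=> Cy hy _ [x [Cx hx] <-]; exact: slopes.
have supA : has_sup A.
  by split; [exists ((v - g p) / h p), p | exists ((v - g q) / h q); exact: ubA].
exists (sup A) => x Cx; have [hx|hx|hx] := ltgtP (h x) 0.
- have : sup A <= (v - g x) / h x by apply: ge_sup; [exact: supA.1|exact: ubA].
  by rewrite ler_ndivlMr //; lra.
- have : (v - g x) / h x <= sup A by apply: ub_le_sup; [exact: supA.2|exists x].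
  by rewrite ler_pdivrMr //; lra.
- by rewrite hx mulr0 addr0 vmin.
Qed.

(** Induction on the list of constraints that have been moved into the objective,
    the others being kept as constraints. The last hypothesis provides points on
    both sides of the hyperplane of each new constraint. *)
Lemma lagrange_multipliers (I : finType) C g (h : I -> X -> R) (v : R) :
  segment_closed C -> affine_fun g -> (forall i, affine_fun (h i)) ->
  (forall x, C x -> (forall i, h i x = 0) -> v <= g x) ->
  (forall e : I -> R, exists2 s, 0 < s &
     exists2 x, C x & forall i, h i x = s * e i) ->
  exists a : I -> R, forall x, C x -> v <= g x + \sum_i a i * h i x.
Proof.
move=> Cconv gaff haff vmin qual.
suff H (r : seq I) : uniq r -> exists a : I -> R, forall x, C x ->
    (forall i, i \notin r -> h i x = 0) -> v <= g x + \sum_(i <- r) a i * h i x.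
  have [a ha] := H (index_enum I) (index_enum_uniq I).
  by exists a => x Cx; apply: ha => // i; rewrite mem_index_enum.
elim: r => [_|j r IH /= /andP[jr ur]].
  exists (fun=> 0) => x Cx hx; rewrite big_nil addr0.
  by apply: vmin => // i; exact: hx.
have [a ha] := IH ur.
pose Cj := [set x | C x /\ forall i, i \notin j :: r -> h i x = 0].
have Cj_conv : segment_closed Cj.
  move=> x y t [Cx hx] [Cy hy] t01; split; first exact: Cconv.
  by move=> i ir; rewrite haff hx // hy // !mulr0 addr0.
have qualj (b : R) : b != 0 -> exists2 x, Cj x & exists2 s, 0 < s & h j x = s * b.
  move=> b0; have [s s0 [x Cx hx]] := qual (fun i => if i == j then b else 0).
  exists x; last by exists s; rewrite // hx eqxx.
  split => // i; rewrite inE negb_or => /andP[/negPf ij _].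
  by rewrite hx ij mulr0.
have gaff' : affine_fun (fun x => g x + \sum_(i <- r) a i * h i x).
  move=> x y t; rewrite gaff.
  under eq_bigr do rewrite haff.
  rewrite !mulrDr !mulr_sumr addrACA -big_split /=; congr (_ + _).
  by apply: eq_bigr => i _; ring.
have [|||b hb] := @lagrange_multiplier1 Cj _ (h j) v Cj_conv gaff' (haff j).
- move=> x [Cx hx] hjx; apply: ha => // i ir.
  by have [->//|ij] := eqVneq i j; apply: hx; rewrite inE negb_or ij.
- have [|x Cx [s s0 hx]] := qualj 1; first exact: oner_neq0.
  by exists x; rewrite // hx mulr1.
- have [|x Cx [s s0 hx]] := qualj (- 1); first by rewrite oppr_eq0 oner_neq0.
  by exists x; rewrite // hx mulrN1 oppr_lt0.
exists (fun i => if i == j then b else a i) => x Cx hx.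
rewrite big_cons eqxx addrCA addrC.
rewrite (eq_big_seq (fun i => a i * h i x)); first exact: hb.
by move=> i ir; case: eqP => // ij; rewrite ij (negPf jr) in ir.
Qed.

End lagrange_multipliers.

(** * Convexity of extended-valued functions and of perspectives *)

Section extended_convexity.
Variable R : realType.

Lemma convex_efunD (X : lmodType R) (f g : X -> \bar R) :
  (forall x, f x != -oo%E) -> (forall x, g x != -oo%E) ->
  convex_efun f -> convex_efun g -> convex_efun (fun x => f x + g x)%E.
Proof.
move=> fNy gNy fconv gconv x y t t01.
have def z : (f z +? g z)%E by apply: ltninfty_adde_def; rewrite inE ltNye.
rewrite !muleDr // addeACA.
by apply: leeD; [exact: fconv|exact: gconv].
Qed.

Lemma convex_efun_sum (X : lmodType R) (I : finType) (f : I -> X -> \bar R) :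
  (forall i x, f i x != -oo%E) -> (forall i, convex_efun (f i)) ->
  convex_efun (fun x => \sum_i f i x)%E.
Proof.
move=> fNy fconv x y t t01.
rewrite !fin_num_sume_distrr -?big_split //=;
  try by move=> i j _ _; apply: ltninfty_adde_def; rewrite inE ltNye.
by apply: lee_sum => i _; exact: fconv.
Qed.

Lemma convex_efun_comp (X Y : lmodType R) (L : X -> Y) (f : Y -> \bar R) :
  (forall x y t, L (t *: x + (1 - t) *: y) = t *: L x + (1 - t) *: L y) ->
  convex_efun f -> convex_efun (f \o L).
Proof. by move=> Laff fconv x y t t01; rewrite /= Laff; exact: fconv. Qed.

Section perspective.
Variables (X : lmodType R) (f : X -> \bar R).

Lemma perspective_neqNy theta z :
  (forall x, f x != -oo%E) -> perspective f theta z != -oo%E.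
Proof.
move=> fNy; rewrite /perspective; case: ifPn => [theta0|_]; last by case: ifP.
have := fNy (theta^-1 *: z); case: (f _) => [r| |] //= _.
by rewrite gt0_muley ?lte_fin.
Qed.

Lemma perspectiveZ s theta z : 0 <= s ->
  perspective f (s * theta) (s *: z) = (s%:E * perspective f theta z)%E.
Proof.
rewrite le_eqVlt => /predU1P[<-|s0].
  by rewrite mul0r scale0r mul0e /perspective ltxx !eqxx.
rewrite /perspective pmulr_rgt0 //; case: ifPn => [theta0|_].
  rewrite scalerA invfM mulrAC mulVf ?lt0r_neq0 // mul1r EFinM muleA //.
rewrite mulf_eq0 scaler_eq0 gt_eqF //=; case: ifP => _; first by rewrite mule0.
by rewrite gt0_muley ?lte_fin.
Qed.

(** A positively homogeneous function is convex as soon as it is subadditive,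
    which for the perspective is the convexity of [f] between the two points
    [z1 / theta1] and [z2 / theta2], with weights proportional to the
    [theta]s. *)
Lemma perspectiveD theta1 theta2 z1 z2 :
  (forall x, f x != -oo%E) -> convex_efun f ->
  (perspective f (theta1 + theta2) (z1 + z2) <=
   perspective f theta1 z1 + perspective f theta2 z2)%E.
Proof.
move=> fNy fconv.
have [p1y|] := eqVneq (perspective f theta1 z1) +oo%E.
  by rewrite p1y addye ?leey ?perspective_neqNy.
have [p2y|] := eqVneq (perspective f theta2 z2) +oo%E.
  by rewrite p2y addey ?leey ?perspective_neqNy.
rewrite /perspective.
case: (ltP 0 theta1) => [theta1_gt0|_]; last first.
  case: (boolP ((theta1 == 0) && (z1 == 0))) =>
    [/andP[/eqP-> /eqP->] _ _|_ _]; last by rewrite eqxx.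
  by rewrite !add0r.
case: (ltP 0 theta2) => [theta2_gt0|_]; last first.
  case: (boolP ((theta2 == 0) && (z2 == 0))) =>
    [/andP[/eqP-> /eqP->] _ _|_]; last by rewrite eqxx.
  by rewrite !addr0 theta1_gt0.
rewrite addr_gt0 //.
have := fconv (theta1^-1 *: z1) (theta2^-1 *: z2) (theta1 / (theta1 + theta2)).
case: (f (theta2^-1 *: z2)) (fNy (theta2^-1 *: z2)) => [r2 _| |] //; last first.
  by move=> _ _; rewrite gt0_muley ?lte_fin // eqxx.
case: (f (theta1^-1 *: z1)) (fNy (theta1^-1 *: z1)) => [r1 _| |] //; last first.
  by move=> _ _ _; rewrite gt0_muley ?lte_fin // eqxx.
have -> : 1 - theta1 / (theta1 + theta2) = theta2 / (theta1 + theta2).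
  by field; lra.
have -> : theta1 / (theta1 + theta2) *: (theta1^-1 *: z1) +
    theta2 / (theta1 + theta2) *: (theta2^-1 *: z2) =
    (theta1 + theta2)^-1 *: (z1 + z2).
  rewrite !scalerA scalerDr; congr (_ *: _ + _ *: _); field; lra.
move=> le_f _ _.
have /le_f {}le_f : 0 <= theta1 / (theta1 + theta2) <= 1.
  by rewrite divr_ge0 ?ler_pdivrMr ?mul1r //; lra.
apply: le_trans (lee_wpmul2l _ le_f) _; first by rewrite lee_fin; lra.
rewrite lee_fin le_eqVlt; apply/orP; left; apply/eqP.
by field; lra.
Qed.

Lemma perspective_convex (theta1 theta2 t : R) (z1 z2 : X) :
  (forall x, f x != -oo%E) -> convex_efun f -> 0 <= t <= 1 ->
  (perspective f (t * theta1 + (1 - t) * theta2) (t *: z1 + (1 - t) *: z2) <=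
   t%:E * perspective f theta1 z1 + (1 - t)%:E * perspective f theta2 z2)%E.
Proof.
move=> fNy fconv /andP[t0 t1].
by rewrite -!perspectiveZ ?subr_ge0 //; exact: perspectiveD.
Qed.

End perspective.
End extended_convexity.

(** * Strong duality *)

Section fenchel_duality.
Variables (R : realType) (T n : nat) (d : mfg_data R T n).
Variable hstd : standing_assumption d.
Local Notation m0 := (mfg_m0 d).
Local Notation alpha := (mfg_alpha d).
Local Notation ell := (mfg_ell d).
Local Notation phi := (mfg_phi d).
Local Notation F := (mfg_F d).

Lemma ell_neqNy t x rho : ell t x rho != -oo%E.
Proof. by have [_ /(_ t x)[[]]] := hstd. Qed.

Lemma F_neqNy s v : F s v != -oo%E.
Proof. by have [_ _ /(_ s)[[]]] := hstd. Qed.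

Lemma phi_neqNy t r : phi t r != -oo%E.
Proof. by have [_ _ _ /(_ t)[[]]] := hstd. Qed.

Lemma sum_neqNy (I : finType) (f : I -> \bar R) :
  (forall i, f i != -oo%E) -> (\sum_i f i)%E != -oo%E.
Proof.
by move=> fNy; rewrite esum_eqNy; apply/existsPn => i; rewrite negb_and fNy orbT.
Qed.

Lemma perspective_ell_neqNy t x theta z : perspective (ell t x) theta z != -oo%E.
Proof. by apply: perspective_neqNy; exact: ell_neqNy. Qed.

Lemma calF_neqNy c : calF d c != -oo%E.
Proof.
case: c => [[[m w] m2] D]; rewrite /calF !adde_eq_ninfty !negb_or.
rewrite !sum_neqNy // => *; [exact: F_neqNy|exact: phi_neqNy|].
by apply: sum_neqNy => x; exact: perspective_ell_neqNy.
Qed.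

Lemma calF_convex : convex_efun (calF d).
Proof.
have [_ hell hF hphi] := hstd.
have -> : calF d = fun c => ((\sum_t \sum_x
    perspective (ell t x) (c.1.1.1 (tnow t) x) (row x (c.1.1.2 t))) +
    (\sum_t phi t (c.2 ord0 t)) + \sum_s F s (row s c.1.2))%E.
  by apply/funext => -[[[]]].
have pNy (c : Cspace R T n) t x :
    perspective (ell t x) (c.1.1.1 (tnow t) x) (row x (c.1.1.2 t)) != -oo%E.
  exact: perspective_ell_neqNy.
apply: convex_efunD => [c|c||].
- rewrite adde_eq_ninfty negb_or !sum_neqNy // => [t|t]; last exact: sum_neqNy.
  exact: phi_neqNy.
- by apply: sum_neqNy => s; exact: F_neqNy.
- apply: convex_efunD => [c|c||].
  + by apply: sum_neqNy => t; exact: sum_neqNy.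
  + by apply: sum_neqNy => t; exact: phi_neqNy.
  + apply: convex_efun_sum => [t c|t]; first exact: sum_neqNy.
    apply: convex_efun_sum => [//|x] c c' r r01.
    have [[ellNy _] ell_conv _ _] := hell t x.
    have := perspective_convex (c.1.1.1 (tnow t) x) (c'.1.1.1 (tnow t) x)
      (row x (c.1.1.2 t)) (row x (c'.1.1.2 t)) ellNy ell_conv r01.
    by rewrite -!linearZ -linearD /= !mxE.
  + apply: convex_efun_sum => [t c|t]; first exact: phi_neqNy.
    have [_ phi_conv _] := hphi t.
    apply: (@convex_efun_comp _ _ R^o (fun c : Cspace R T n => c.2 ord0 t)) => //.
    by move=> c c' r; rewrite /= !mxE.
- apply: convex_efun_sum => [s c|s]; first exact: F_neqNy.
  have [_ F_conv _] := hF s.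
  apply: (@convex_efun_comp _ _ _ (fun c : Cspace R T n => row s c.1.2)) => //.
  by move=> c c' r; rewrite /= linearD !linearZ.
Qed.

(** One finite index type for the entries of the three blocks of constraints, so
    that they are treated uniformly as scalar constraints. *)
Definition coordK (k : Kspace R T n)
    (i : 'I_T.+1 * 'I_n + 'I_T.+1 * 'I_n + 'I_T) : R :=
  match i with
  | inl (inl p) => k.1.1 p.1 p.2
  | inl (inr p) => k.1.2 p.1 p.2
  | inr t => k.2 ord0 t
  end.

Lemma dotK_coord y k : dotK y k = \sum_i coordK y i * coordK k i.
Proof.
case: y => [[y1 y2] y3]; case: k => [[u gamma] P].
by rewrite !big_sumType /= /dot big_ord1 !pair_bigA.
Qed.

Lemma coordK_surj a : exists k, forall i, coordK k i = a i.
Proof.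
exists (\matrix_(s, x) a (inl (inl (s, x))), \matrix_(s, x) a (inl (inr (s, x))),
  \row_t a (inr t)).
by move=> [[[s x]|[s x]]|t]; rewrite /= mxE.
Qed.

Lemma coordK_inj k k' : (forall i, coordK k i = coordK k' i) -> k = k'.
Proof.
case: k => [[u gamma] P]; case: k' => [[u' gamma'] P'] h.
congr (_, _, _); apply/matrixP => i j.
- exact: (h (inl (inl (i, j)))).
- exact: (h (inl (inr (i, j)))).
- rewrite (ord1 i); exact: (h (inr j)).
Qed.

Lemma coordK_calA_affine i : affine_fun (fun c => coordK (calA d c) i).
Proof.
move=> [[[m w] m2] D] [[[m' w'] m2'] D'] t.
have sumE (J : finType) (f g : J -> R) :
    \sum_j (t * f j + (1 - t) * g j) = t * \sum_j f j + (1 - t) * \sum_j g j.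
  by rewrite big_split /= -!mulr_sumr.
case: i => [[[s x]|[s x]]|s]; rewrite /= !mxE.
- case: (unlift ord0 s) => [r|]; last by ring.
  under eq_bigr do rewrite !mxE.
  by rewrite sumE; ring.
- by ring.
- under eq_bigr => x _ do
    (under eq_bigr do rewrite !mxE mulrDl -!mulrA; rewrite sumE).
  by rewrite sumE; ring.
Qed.

Definition target : Kspace R T n := (- bar_m0 d, 0, 0).

Lemma dotKZ (s : R) (k k' : Kspace R T n) : dotK (s *: k) k' = s * dotK k k'.
Proof.
rewrite !dotK_coord mulr_sumr; apply: eq_bigr => -[[[i j]|[i j]]|i] _ /=;
by rewrite !mxE mulrA.
Qed.

Lemma dotK_sym (k k' : Kspace R T n) : dotK k k' = dotK k' k.
Proof. by rewrite !dotK_coord; apply: eq_bigr => i _; rewrite mulrC. Qed.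

Lemma dotKB (y y' k : Kspace R T n) : dotK (y - y') k = dotK y k - dotK y' k.
Proof.
case: y y' k => [[y1 y2] y3] [[y1' y2'] y3'] [[u gamma] P] /=.
by rewrite !dotDl !dotNl; ring.
Qed.

Lemma normKZ (s : R) (k : Kspace R T n) : 0 <= s -> normK (s *: k) = s * normK k.
Proof.
move=> s0; rewrite /normK dotKZ dotK_sym dotKZ mulrA -expr2.
by rewrite sqrtrM ?sqr_ge0 // sqrtr_sqr ger0_norm.
Qed.

Lemma calF_lty (m : flow R T n) (w : kern R T n) (m2 : flow R T n) (D : price R T) :
  (forall t x, perspective (ell t x) (m (tnow t) x) (row x (w t)) < +oo)%E ->
  (forall t, phi t (D ord0 t) < +oo)%E -> (forall s, F s (row s m2) < +oo)%E ->
  (calF d (m, w, m2, D) < +oo)%E.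
Proof.
move=> h1 h2 h3; rewrite /calF; apply: lte_add_pinfty; last exact: lte_sum_pinfty.
apply: lte_add_pinfty; last exact: lte_sum_pinfty.
by apply: lte_sum_pinfty => t _; exact: lte_sum_pinfty.
Qed.

(** Every direction is reached at finite cost: the flow driven by the policy that
    the qualification provides, with its kernel [m pi], whose cost per state
    is [m * ell(pi)]. *)
Lemma qualification_direction : qualification d -> forall e : Kspace R T n,
  exists2 s, 0 < s & exists2 c, (calF d c < +oo)%E & calA d c = target + s *: e.
Proof.
move=> [a0 a0_gt0 hq] [[e1 e2] e3].
(* The perturbed flow adds its perturbation at time 0 and subtracts it later,
   hence the change of sign. *)
pose f1 : flow R T n := \matrix_(s, x) if s == ord0 then - e1 s x else e1 s x.
pose f : Kspace R T n := (f1, - e2, - e3).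
pose s := a0 / (1 + normK f).
have nf0 : 0 <= normK f by exact: sqrtr_ge0.
have s_gt0 : 0 < s by rewrite divr_gt0 //; lra.
exists s => //.
have le_a0 : normK (s *: f) <= a0.
  rewrite normKZ; last exact: ltW.
  by rewrite /s mulrAC ler_pdivrMr; nra.
have [pi [m [hpi [hm0 hm] m_ge0 hF hphi]]] := hq _ _ _ le_a0.
pose w : kern R T n := fun t => \matrix_(x, y) (m (tnow t) x * pi t x y).
exists (m, w, m + s *: - e2, opA d w + s *: - e3).
  apply: calF_lty => [t x|t|r]; last exact: hF.
    have -> : row x (w t) = m (tnow t) x *: row x (pi t).
      by apply/rowP => y; rewrite !mxE.
    rewrite -[X in perspective _ X]mulr1 perspectiveZ //.
    rewrite /perspective ltr01 invr1 scale1r mul1e.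
    have := hpi t x; rewrite /effdom /=; have := ell_neqNy t x (row x (pi t)).
    by case: (ell _ _ _) => // r _ _; rewrite -EFinM ltry.
  have := hphi t; rewrite /effdom /= !mxE.
  congr (phi t (_ + _) < +oo)%E; apply: eq_bigr => x _.
  by apply: eq_bigr => y _; rewrite mxE.
rewrite /calA /target; congr (_, _, _).
- apply/matrixP => r x; rewrite !mxE.
  case: (unliftP ord0 r) => [t ->|->] /=.
    have := hm t x; rewrite !mxE /= => ->.
    rewrite oppr0 add0r /w; under eq_bigr do rewrite mxE.
    by ring.
  have := hm0 x; rewrite !mxE eqxx /=; lra.
- by rewrite add0r scalerN opprD opprK addrA subrr add0r.
- by rewrite add0r scalerN opprD opprK addrA subrr add0r.
Qed.

(** Existence of a multiplier: the constraint is affine, and the qualification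
    says that its values at finite cost surround the target. *)
Lemma multiplier_exists (v : R) : qualification d ->
  (forall c, calA d c = target -> v%:E <= calF d c)%E ->
  exists k, forall c, (v%:E <= calF d c + (dotK (calA d c - target) k)%:E)%E.
Proof.
move=> hq hv.
pose C := [set z : Cspace R T n * R^o | (calF d z.1 <= (z.2 : R)%:E)%E].
pose h i (z : Cspace R T n * R^o) := coordK (calA d z.1) i - coordK target i.
have [|||||a ha] := @lagrange_multipliers R _ _ C (fun z => z.2) h v.
- move=> z z' t Cz Cz' t01.
  have := t01 => /andP[t0 t1].
  suff le_r : (t%:E * calF d z.1 + (1 - t)%:E * calF d z'.1 <=
      (t * z.2 + (1 - t) * z'.2)%:E)%E by exact: le_trans (calF_convex _ _ t01) le_r.
  by apply: (leeD (lee_wpmul2l _ Cz) (lee_wpmul2l _ Cz'));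
    rewrite lee_fin ?subr_ge0.
- by [].
- by move=> i z z' t; rewrite /h /= coordK_calA_affine; ring.
- move=> z Cz hz; rewrite -lee_fin; apply: le_trans Cz; apply: hv.
  by apply: coordK_inj => i; apply/eqP; rewrite -subr_eq0; apply/eqP; exact: hz.
- move=> e; have [k ke] := coordK_surj e.
  have [s s0 [c Fc Ac]] := qualification_direction hq k.
  exists s => //; exists (c, fine (calF d c)) => [|i].
    by rewrite /C /= fineK // fin_numElt Fc ltNye calF_neqNy.
  rewrite /h /= Ac -ke; case: i => [[[i j]|[i j]]|i] /=; rewrite !mxE; ring.
have [k ka] := coordK_surj a; exists k => c.
have [->|Fy] := eqVneq (calF d c) +oo%E; first by rewrite addye ?leey.
have Ff : calF d c \is a fin_num by rewrite fin_numE Fy calF_neqNy.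
have Cc : C (c, fine (calF d c)) by rewrite /C /= fineK.
have : v <= fine (calF d c) + \sum_i a i * h i (c, fine (calF d c)).
  exact (ha _ Cc).
rewrite -lee_fin EFinD fineK // => /le_trans le_v; apply: le_v.
rewrite dotK_coord leeD2lE // lee_fin le_eqVlt; apply/orP; left; apply/eqP.
apply: eq_bigr => i _; rewrite ka mulrC; congr (_ * _); rewrite /h /=.
by case: i => [[[i j]|[i j]]|i] /=; rewrite !mxE.
Qed.

(** Minimality in the dual problem turns into a Lagrangian inequality: the
    conjugate of the indicator is [dotK target], and expanding the supremum
    that defines the other conjugate gives the inequality at every [c]. *)
Lemma dual_solution_lagrangian k (v : R) : qualification d ->
  (forall c, calA d c = target -> v%:E <= calF d c)%E ->
  dual_solution d k ->
  forall c, (v%:E <= calF d c + (dotK (calA d c - target) k)%:E)%E.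
Proof.
move=> hq hv [_ k_min].
have dotCN c k' : dotC (- calA_adj d k') c = - dotK (calA d c) k'.
  rewrite calA_adj_formulaP -calA_adjE.
  case: (calA_adj d k') c => [[[m w] m2] D] [[[m' w'] m2'] D'] /=.
  have -> : dot_kern (- w) w' = - dot_kern w' w.
    rewrite /dot_kern -sumrN; apply: eq_bigr => t _.
    by rewrite dotC_sym dotNr.
  rewrite !dotNl (dotC_sym m) (dotC_sym m2) (dotC_sym D); ring.
have [k' hk'] := multiplier_exists hq hv.
have dual_k' : (dual_obj d k' <= (- v)%:E)%E.
  have le_F : (conjugate (@dotC R T n) (calF d) (- calA_adj d k')%R <=
      (- v - dotK target k')%:E)%E.
    apply: ge_ereal_sup => _ [c _ <-]; rewrite dotCN; move: (hk' c); rewrite dotKB.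
    case: (calF d c) (calF_neqNy c) => [r| |] // _; last by rewrite leNye.
    by rewrite !lee_fin; lra.
  have le_G : (conjugate (@dotK R T n) (calG d) k' <= (dotK target k')%:E)%E.
    apply: ge_ereal_sup => _ [y _ <-]; rewrite /calG.
    case: eqP => [->|_]; last by rewrite leNye.
    by rewrite sube0 dotK_sym.
  by apply: le_trans (leeD le_F le_G) _; rewrite lee_fin; lra.
have dual_k : (dual_obj d k <= (- v)%:E)%E.
  by rewrite k_min; apply: le_trans dual_k'; apply: ereal_inf_lbound; exists k'.
move=> c; have [->|Fy] := eqVneq (calF d c) +oo%E; first by rewrite addye ?leey.
have Ff : calF d c \is a fin_num by rewrite fin_numE Fy calF_neqNy.
have : ((- dotK (calA d c) k)%:E - calF d c + (dotK k target)%:E <= (- v)%:E)%E.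
  apply: le_trans dual_k; apply: leeD.
    by apply: ereal_sup_ubound; exists c; rewrite // dotCN.
  by apply: ereal_sup_ubound; exists target; rewrite // /calG eqxx sube0.
move: Ff; case: (calF d c) => // r _.
by rewrite dotKB (dotK_sym k) !lee_fin; lra.
Qed.

End fenchel_duality.

(** * Optimality conditions, block by block *)

Section optimality.
Variables (R : realType) (T n : nat) (d : mfg_data R T n).
Variable hstd : standing_assumption d.
Local Notation m0 := (mfg_m0 d).
Local Notation alpha := (mfg_alpha d).
Local Notation ell := (mfg_ell d).
Local Notation phi := (mfg_phi d).
Local Notation F := (mfg_F d).
Variables (m : flow R T n) (w : kern R T n) (m2 : flow R T n) (D : price R T).
Variables (gamma : flow R T n) (P : price R T).
Implicit Types u v : flow R T n.

(** Cancels the unchanged terms when a single block of variables is moved. *)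
Lemma sum_update (I : finType) (i : I) (f g : I -> \bar R) (r : R) :
  (forall j, f j \is a fin_num) -> (forall j, j != i -> g j = f j) ->
  (\sum_j f j <= \sum_j g j + r%:E)%E -> (f i <= g i + r%:E)%E.
Proof.
move=> ffin gf; rewrite (bigD1 i) // [X in (_ <= X + _)%E](bigD1 i) //=.
rewrite [X in (_ <= _ + X + _)%E](eq_bigr f) // addeAC leeD2rE //.
by apply/sum_fin_numP => j _ _.
Qed.

Definition row_at p q (s : 'I_p) (v : 'rV[R]_q) : 'M[R]_(p, q) :=
  \matrix_(i, j) if i == s then v ord0 j else 0.

Lemma dot_row_at p q (s : 'I_p) (v : 'rV[R]_q) (b : 'M[R]_(p, q)) :
  dot (row_at s v) b = dot v (row s b).
Proof.
rewrite /dot big_ord1 (bigD1 s) //= [X in _ + X]big1 ?addr0.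
  by apply: eq_bigr => j _; rewrite !mxE eqxx.
by move=> i /negPf is_; apply: big1 => j _; rewrite mxE is_ mul0r.
Qed.

Lemma row_row_at p q (s i : 'I_p) (v : 'rV[R]_q) :
  row i (row_at s v) = if i == s then v else 0.
Proof. by apply/rowP => j; rewrite !mxE; case: eqP; rewrite ?mxE. Qed.

Lemma dot_delta p q (i : 'I_p) (j : 'I_q) a (b : 'M[R]_(p, q)) :
  dot (a *: delta_mx i j) b = a * b i j.
Proof.
rewrite /dot (bigD1 i) //= [X in _ + X]big1 ?addr0.
  rewrite (bigD1 j) //= [X in _ + X]big1 ?addr0 ?mxE ?eqxx ?mulr1 //.
  by move=> k /negPf kj; rewrite !mxE eqxx kj mulr0 mul0r.
by move=> k /negPf ki; apply: big1 => l _; rewrite !mxE ki mulr0 mul0r.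
Qed.

Lemma dot0l p q (b : 'M[R]_(p, q)) : dot 0 b = 0.
Proof. by apply: big1 => i _; apply: big1 => j _; rewrite mxE mul0r. Qed.

Lemma dot_kern0l (b : kern R T n) : dot_kern 0 b = 0.
Proof. by apply: big1 => t _; exact: dot0l. Qed.

Definition kern_at (t : 'I_T) (x : 'I_n) (z : 'rV[R]_n) : kern R T n :=
  fun r => if r == t then row_at x z else 0.

Lemma dot_kern_at t x z (b : kern R T n) :
  dot_kern (kern_at t x z) b = dot z (row x (b t)).
Proof.
rewrite /dot_kern (bigD1 t) //= [X in _ + X]big1 ?addr0 => [|r /negPf rt].
  by rewrite /kern_at eqxx dot_row_at.
by rewrite /kern_at rt dot0l.
Qed.

Lemma row_kern_at t x z (v : kern R T n) r y :
  row y ((v + kern_at t x z) r) =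
  row y (v r) + if (r == t) && (y == x) then z else 0.
Proof.
have -> : (v + kern_at t x z) r = v r + kern_at t x z r by [].
rewrite linearD /= /kern_at; case: (r == t) => /=; first by rewrite row_row_at.
by rewrite linear0.
Qed.

(** The part of the Lagrangian that is linear in the mass [theta] at [(t, x)] and
    in the flow [z] leaving it. *)
Definition edge_cost (u : flow R T n) t x (theta : R) (z : 'rV[R]_n) : R :=
  theta * (gamma (tnow t) x - u (tnow t) x) +
  \sum_y z ord0 y * (u (tnext t) y + alpha t x y * P ord0 t).

Definition dual_feasible u : Prop := forall t x theta z,
  (0 <= perspective (ell t x) theta z + (edge_cost u t x theta z)%:E)%E.

Lemma edge_costD u t x theta theta' z z' :
  edge_cost u t x (theta + theta') (z + z') =
  edge_cost u t x theta z + edge_cost u t x theta' z'.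
Proof.
rewrite /edge_cost mulrDl addrACA -big_split /=; congr (_ + _).
by apply: eq_bigr => y _; rewrite mxE mulrDl.
Qed.

Lemma edge_costZ u t x r theta z :
  edge_cost u t x (r * theta) (r *: z) = r * edge_cost u t x theta z.
Proof.
rewrite /edge_cost [RHS]mulrDr mulrA mulr_sumr; congr (_ + _).
by apply: eq_bigr => y _; rewrite mxE mulrA.
Qed.

Section subgradient.
Variable u : flow R T n.
Hypothesis calF_fin : calF d (m, w, m2, D) \is a fin_num.
Hypothesis subgradient : forall dm dw dm2 dD,
  (calF d (m, w, m2, D) <= calF d (m + dm, w + dw, m2 + dm2, D + dD)%R +
    (dotC (dm, dw, dm2, dD) (calA_adj_formula d (u, gamma, P)))%:E)%E.

Let mass_term t x := perspective (ell t x) (m (tnow t) x) (row x (w t)).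

Lemma calF_parts_fin :
  [/\ forall t x, mass_term t x \is a fin_num,
      forall t, phi t (D ord0 t) \is a fin_num
    & forall s, F s (row s m2) \is a fin_num].
Proof.
have := calF_fin; rewrite /calF !fin_numD => /andP[/andP[h1 h2] h3]; split.
- move=> t x; have /sum_fin_numP/(_ t (mem_index_enum _) isT) := h1.
  by move=> /sum_fin_numP/(_ x (mem_index_enum _) isT).
- by move=> t; have /sum_fin_numP/(_ t (mem_index_enum _) isT) := h2.
- by move=> s; have /sum_fin_numP/(_ s (mem_index_enum _) isT) := h3.
Qed.

Lemma phi_subgradient t :
  subdiff (fun a b : R => a * b) (phi t) (D ord0 t) (P ord0 t).
Proof.
have [fin1 fin2 fin3] := calF_parts_fin; move=> r.
have := subgradient 0 0 0 ((r - D ord0 t) *: delta_mx ord0 t).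
rewrite /calA_adj_formula /dotC !dot0l dot_kern0l !add0r dot_delta !addr0 /calF.
set A := (\sum_t \sum_x _)%E; set C := (\sum_s F s _)%E.
have Afin : A \is a fin_num.
  by apply/sum_fin_numP => s _ _; apply/sum_fin_numP => x _ _; exact: fin1.
have Cfin : C \is a fin_num by apply/sum_fin_numP => s _ _; exact: fin3.
rewrite [leRHS]addeAC leeD2rE // -addeA leeD2lE // => le_phi.
have := @sum_update _ t _ _ _ fin2 _ le_phi; rewrite !mxE !eqxx mulr1 subrKC.
have := fin2 t; case: (phi t (D ord0 t)) => // a _ le_r.
have {}le_r : (a%:E <= phi t r + ((r - D ord0 t) * - P ord0 t)%:E)%E.
  apply: le_r => s /negPf st; rewrite !mxE st mulr0 addr0 //.
by move: le_r; case: (phi t r) => [b| |] //; rewrite ?leey // !lee_fin; lra.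
Qed.

Lemma F_subgradient s :
  subdiff (@dot R 1 n) (F s) (row s m2) (row s gamma).
Proof.
have [fin1 fin2 fin3] := calF_parts_fin; move=> v.
have := subgradient 0 0 (row_at s (v - row s m2)) 0.
rewrite /calA_adj_formula /dotC !dot0l dot_kern0l !add0r dot_row_at !addr0 /calF.
set A := (\sum_t \sum_x _)%E; set B := (\sum_t phi t _)%E.
have Afin : A \is a fin_num.
  by apply/sum_fin_numP => t _ _; apply/sum_fin_numP => x _ _; exact: fin1.
have Bfin : B \is a fin_num by apply/sum_fin_numP => t _ _; exact: fin2.
rewrite -[leRHS]addeA leeD2lE ?fin_numD ?Afin // => le_F.
have := @sum_update _ s _ _ _ fin3 _ le_F; rewrite linearD /= row_row_at eqxx subrKC.
rewrite (dotC_sym (v - _)) linearN /= dotNl.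
have := fin3 s; case: (F s (row s m2)) => // a _ le_r.
have {}le_r : (a%:E <= F s v + (- dot (row s gamma) (v - row s m2))%:E)%E.
  by apply: le_r => r /negPf rs; rewrite linearD /= row_row_at rs addr0.
by move: le_r; case: (F s v) => [b| |] //; rewrite ?leey // !lee_fin; lra.
Qed.

(** [calF] does not involve the first flow at the final time: the Lagrangian is
    linear there, with slope [gamma - u], and bounded below. *)
Lemma terminal_condition x : u ord_max x = gamma ord_max x.
Proof.
have := subgradient ((u ord_max x - gamma ord_max x) *: delta_mx ord_max x) 0 0 0.
rewrite /calA_adj_formula /dotC !dot0l dot_kern0l dot_delta !addr0.
have -> : calF d (m + (u ord_max x - gamma ord_max x) *: delta_mx ord_max x,
    w, m2, D) = calF d (m, w, m2, D).
  rewrite /calF; congr (_ + _ + _)%E; apply: eq_bigr => t _; apply: eq_bigr => y _.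
  rewrite !mxE; have /negPf -> : tnow t != ord_max.
    by rewrite -val_eqE /= neq_ltn ltn_ord.
  by rewrite mulr0 addr0.
move: calF_fin; case: (calF _ _) => // a _; rewrite !mxE lee_fin => ?.
apply/eqP; rewrite -subr_eq0 -sqrf_eq0; apply/eqP/le_anti; rewrite sqr_ge0 andbT.
by rewrite expr2; lra.
Qed.

Lemma mass_term_le t x a z :
  (mass_term t x <= perspective (ell t x) (m (tnow t) x + a) (row x (w t) + z) +
    (edge_cost u t x a z)%:E)%E.
Proof.
have [fin1 fin2 fin3] := calF_parts_fin.
have := subgradient (a *: delta_mx (tnow t) x) (kern_at t x z) 0 0.
rewrite /calA_adj_formula /dotC !dot0l dot_kern_at dot_delta !addr0 /calF.
set B := (\sum_t phi t _)%E; set C := (\sum_s F s _)%E.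
have Bfin : B \is a fin_num by apply/sum_fin_numP => s _ _; exact: fin2.
have Cfin : C \is a fin_num by apply/sum_fin_numP => s _ _; exact: fin3.
rewrite [leRHS]addeAC leeD2rE // [leRHS]addeAC leeD2rE // !pair_bigA => le_w.
have := @sum_update _ (t, x) (fun p => mass_term p.1 p.2) _ _
  (fun p => fin1 p.1 p.2) _ le_w.
rewrite /= row_kern_at !eqxx !mxE !eqxx mulr1.
have -> : a * (gamma (tnow t) x - u (tnow t) x) + dot z (row x (\matrix_(x, y)
    (u (tnext t) y + alpha t x y * P ord0 t))) = edge_cost u t x a z.
  rewrite /edge_cost /dot big_ord1; congr (_ + _); apply: eq_bigr => y _.
  by rewrite !mxE.
apply; case=> s y /=; rewrite row_kern_at !mxE xpair_eqE => sy.
have -> : (tnow s == tnow t) = (s == t) by [].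
rewrite (negPf sy) addr0.
by rewrite mulr0 addr0.
Qed.

(** [perspective (ell t x)] is positively homogeneous, so its subgradients at
    a point are the linear minorants that are exact there. *)
Lemma mass_term_edge_cost t x :
  mass_term t x = (- edge_cost u t x (m (tnow t) x) (row x (w t)))%:E.
Proof.
have [/(_ t x) fin1 _ _] := calF_parts_fin.
have scale s : 0 <= 1 + s -> (mass_term t x <= (1 + s)%:E * mass_term t x +
    (s * edge_cost u t x (m (tnow t) x) (row x (w t)))%:E)%E.
  move=> s0; rewrite -edge_costZ /mass_term -perspectiveZ //.
  by rewrite mulrDl mul1r scalerDl scale1r; exact: mass_term_le.
(* Doubling the block and removing it bound its value from both sides. *)
have := scale 1; have := scale (- 1); move: fin1; case: (mass_term t x) => // q _.
rewrite -!EFinM -!EFinD !lee_fin => h1 h2; congr EFin.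
apply/le_anti/andP; split; lra.
Qed.

Lemma subgradient_feasible : dual_feasible u.
Proof.
move=> t x theta z.
have := mass_term_le t x (theta - m (tnow t) x) (z - row x (w t)).
rewrite mass_term_edge_cost !subrKC => le_cost.
have := edge_costD u t x (m (tnow t) x) (theta - m (tnow t) x) (row x (w t))
  (z - row x (w t)); rewrite !subrKC => ->.
move: le_cost; case: (perspective _ _ _) => [b| |] // le_cost; rewrite ?leey //.
by move: le_cost; rewrite !lee_fin; lra.
Qed.

End subgradient.

(** * Comparison with the value function *)

Lemma edge_cost_unit u t x rho :
  edge_cost u t x 1 rho = gamma (tnow t) x - u (tnow t) x +
    \sum_y rho ord0 y * (u (tnext t) y + alpha t x y * P ord0 t).
Proof. by rewrite /edge_cost mul1r. Qed.

(** By homogeneity, feasibility needs to be tested at unit mass only, where it is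
    a Bellman inequality. *)
Lemma dual_feasible_unit u : dual_feasible u <->
  forall t x rho, (0 <= ell t x rho + (edge_cost u t x 1 rho)%:E)%E.
Proof.
split=> [uf t x rho|uf t x theta z].
  by have := uf t x 1 rho; rewrite {1}/perspective ltr01 invr1 scale1r mul1e.
have [theta_gt0|theta_le0] := ltP 0 theta; last first.
  rewrite /perspective ltNge theta_le0 /=.
  case: ifP => [/andP[/eqP-> /eqP->]|_]; last by rewrite leey.
  rewrite /edge_cost mul0r add0r big1 ?adde0 // => y _.
  by rewrite mxE mul0r.
rewrite -[in edge_cost _ _ _ _](mulr1 theta).
rewrite -[z in edge_cost _ _ _ _ z](scalerKV (lt0r_neq0 theta_gt0)) edge_costZ.
rewrite /perspective theta_gt0.
move: (uf t x (theta^-1 *: z)).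
case: (ell t x _) => [r| |] //; last by rewrite gt0_muley ?lte_fin // leey.
by rewrite -EFinM -!EFinD !lee_fin => h; rewrite -mulrDr mulr_ge0 // ltW.
Qed.

Lemma dot_hjb u t x rho :
  dot (\row_y (- alpha t x y * P ord0 t - u (tnext t) y)) rho =
  - \sum_y rho ord0 y * (u (tnext t) y + alpha t x y * P ord0 t).
Proof.
by rewrite /dot big_ord1 -sumrN; apply: eq_bigr => y _; rewrite mxE; ring.
Qed.

Lemma hjb_feasible u : hjb d gamma P u -> dual_feasible u.
Proof.
move=> [hu _]; apply/dual_feasible_unit => t x rho.
have := hu t x; set y := \row__ _; set c := conjugate _ _ _ => uc.
have : ((dot y rho)%:E - ell t x rho <= c)%E.
  by apply: ereal_sup_ubound; exists rho.
rewrite dot_hjb edge_cost_unit.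
case: c uc => // c [<-].
case: (ell t x rho) (ell_neqNy hstd t x rho) => // [r _|_ _].
  by rewrite -EFinB -EFinD !lee_fin; lra.
by rewrite leey.
Qed.

Lemma bellman_edge_cost u t x rho :
  (bellman d u P t x rho + (gamma (tnow t) x)%:E =
   ell t x rho + (edge_cost u t x 1 rho + u (tnow t) x)%:E)%E.
Proof.
rewrite /bellman edge_cost_unit -addeA -EFinD; congr (_ + _%:E)%E.
have -> : \sum_y rho ord0 y * (alpha t x y * P ord0 t + u (tnext t) y) =
    \sum_y rho ord0 y * (u (tnext t) y + alpha t x y * P ord0 t).
  by apply: eq_bigr => y _; rewrite addrC.
by ring.
Qed.

Lemma hjb_le u t x rho : hjb d gamma P u ->
  ((u (tnow t) x)%:E <= bellman d u P t x rho + (gamma (tnow t) x)%:E)%E.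
Proof.
move=> /hjb_feasible /dual_feasible_unit/(_ t x rho); rewrite bellman_edge_cost.
case: (ell t x rho) => // [r|_]; last by rewrite leey.
by rewrite -!EFinD !lee_fin; lra.
Qed.

(** The conjugate of [ell] is a supremum over the whole space, which is one over
    the simplex since [ell] is infinite elsewhere. *)
Lemma hjb_dynamic_programming u t x : hjb d gamma P u ->
  (u (tnow t) x)%:E = ereal_inf
    [set (bellman d u P t x rho + (gamma (tnow t) x)%:E)%E | rho in @simplex R n].
Proof.
move=> hu; set i := ereal_inf _.
have le_u r : (r%:E <= i)%E -> r <= u (tnow t) x.
  move=> ri; have := hu.1 t x; set c := conjugate _ _ _ => uc.
  suff : (c <= (gamma (tnow t) x - r)%:E)%E.
    by case: c uc => // c [<-]; rewrite lee_fin; lra.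
  apply: ge_ereal_sup => _ [rho _ <-]; rewrite dot_hjb.
  have [->|ell_y] := eqVneq (ell t x rho) +oo%E; first by rewrite leNye.
  have [_ /(_ t x)[_ _ _ dom] _ _] := hstd.
  have rhoS : simplex rho by apply: dom; rewrite /effdom /= ltey.
  have : (r%:E <= bellman d u P t x rho + (gamma (tnow t) x)%:E)%E.
    by apply: le_trans ri _; apply: ereal_inf_lbound; exists rho.
  rewrite bellman_edge_cost edge_cost_unit.
  move: ell_y (ell_neqNy hstd t x rho).
  by case: (ell t x rho) => // a _ _; rewrite -EFinB -EFinD !lee_fin; lra.
have : ((u (tnow t) x)%:E <= i)%E.
  by apply: le_ereal_inf_tmp => _ [rho _ <-]; exact: hjb_le.
case: i le_u => [r|le_u|] //; last first.
  by have := le_u (u (tnow t) x + 1); rewrite leey gerDl ler10 => /(_ isT).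
by rewrite lee_fin => /(_ r (lexx _)) ru ur; congr EFin; apply/le_anti/andP.
Qed.

(** A feasible point is a subsolution of the dynamic programming equation, and
    the comparison goes backwards in time because transition probabilities are
    nonnegative. *)
Lemma feasible_le_hjb u v : dual_feasible u ->
  (forall x, u ord_max x = gamma ord_max x) -> hjb d gamma P v ->
  forall s x, u s x <= v s x.
Proof.
move=> /dual_feasible_unit uf uT hv; have [_ vT] := hv.
suff H k (s : 'I_T.+1) : (T - k <= s)%N -> forall x, u s x <= v s x.
  by move=> s; apply: (H T); rewrite subnn.
elim: k s => [|k IH] s hs x.
  have -> : s = ord_max.
    by apply/val_inj/eqP; rewrite /= eqn_leq -ltnS ltn_ord -[X in (X <= _)%N]subn0.
  by rewrite uT vT.
have [ts|sT] := leqP T s.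
  have -> : s = ord_max by apply/val_inj/eqP; rewrite /= eqn_leq -ltnS ltn_ord.
  by rewrite uT vT.
pose t := Ordinal sT; have -> : s = tnow t by exact: val_inj.
have le_next y : u (tnext t) y <= v (tnext t) y.
  by apply: IH; rewrite lift0 /=; move: hs; rewrite subnS; case: (T - k)%N.
rewrite -lee_fin (hjb_dynamic_programming t x hv).
apply: le_ereal_inf_tmp => _ [rho [rho01 _] <-]; rewrite bellman_edge_cost.
have : \sum_y rho ord0 y * (u (tnext t) y + alpha t x y * P ord0 t) <=
    \sum_y rho ord0 y * (v (tnext t) y + alpha t x y * P ord0 t).
  apply: ler_sum => y _; apply: ler_wpM2l; first by have /andP[] := rho01 y.
  by rewrite lerD2r.
move: (uf t x rho); rewrite !edge_cost_unit.
case: (ell t x rho) => // [r|_ _]; last by rewrite leey.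
by rewrite -!EFinD !lee_fin; lra.
Qed.

Section complementarity.
Hypothesis m_init : forall x, m ord0 x = m0 ord0 x.
Hypothesis m_next : forall (t : 'I_T) x, m (tnext t) x = \sum_y w t y x.

(** The terms in [u] at the two ends of each time step telescope, because the
    outgoing flow of a step is the mass at the next one. *)
Lemma sum_edge_cost u : (forall x, u ord_max x = gamma ord_max x) ->
  \sum_t \sum_x edge_cost u t x (m (tnow t) x) (row x (w t)) =
  \sum_s \sum_x m s x * gamma s x +
  \sum_t \sum_x \sum_y w t x y * (alpha t x y * P ord0 t) -
  \sum_x m0 ord0 x * u ord0 x.
Proof.
move=> uT.
pose g s := \sum_x m s x * u s x.
have cost_t t : \sum_x edge_cost u t x (m (tnow t) x) (row x (w t)) =
    \sum_x m (tnow t) x * gamma (tnow t) x - g (tnow t) + (g (tnext t) +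
    \sum_x \sum_y w t x y * (alpha t x y * P ord0 t)).
  have -> : g (tnext t) = \sum_x \sum_y w t x y * u (tnext t) y.
    rewrite exchange_big; apply: eq_bigr => y _ /=.
    by rewrite m_next mulr_suml.
  rewrite -sumrB -!big_split; apply: eq_bigr => x _ /=.
  rewrite -big_split /= /edge_cost mulrBr; congr (_ + _).
  by apply: eq_bigr => y _; rewrite mxE mulrDr.
rewrite (eq_bigr _ (fun t _ => cost_t t)) !big_split /= sumrN.
rewrite [X in _ = X + _ - _]big_ord_recr /=.
have g_sum : \sum_t g (tnow t) + g ord_max = g ord0 + \sum_t g (tnext t).
  by rewrite -big_ord_recl big_ord_recr.
have -> : \sum_x m ord_max x * gamma ord_max x = g ord_max.
  by apply: eq_bigr => x _; rewrite uT.
have -> : \sum_x m0 ord0 x * u ord0 x = g ord0.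
  by apply: eq_bigr => x _; rewrite m_init.
lra.
Qed.

(** By [sum_edge_cost], raising [u] to [v] changes the total slack by the sum of
    [m0 * (u(0) - v(0))], which is nonpositive: the slacks at [v] are
    nonnegative and their sum is at most the sum of those at [u], which is 0. *)
Lemma tight_transfer u v :
  (forall x, u ord_max x = gamma ord_max x) ->
  (forall x, v ord_max x = gamma ord_max x) ->
  dual_feasible v -> (forall s x, u s x <= v s x) ->
  (forall t x, perspective (ell t x) (m (tnow t) x) (row x (w t)) =
     (- edge_cost u t x (m (tnow t) x) (row x (w t)))%:E) ->
  forall t x, perspective (ell t x) (m (tnow t) x) (row x (w t)) =
     (- edge_cost v t x (m (tnow t) x) (row x (w t)))%:E.
Proof.
move=> uT vT vf uv tight.
pose cost z t x := edge_cost z t x (m (tnow t) x) (row x (w t)).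
have gap_ge0 t x : 0 <= cost v t x - cost u t x.
  have := vf t x (m (tnow t) x) (row x (w t)); rewrite tight.
  by rewrite -EFinD lee_fin addrC.
have gap_le0 : \sum_t \sum_x (cost v t x - cost u t x) <= 0.
  under eq_bigr do rewrite sumrB.
  rewrite sumrB /cost !sum_edge_cost //.
  suff : \sum_x m0 ord0 x * u ord0 x <= \sum_x m0 ord0 x * v ord0 x by lra.
  apply: ler_sum => x _; apply: ler_wpM2l => //.
  by have [[/(_ x)/andP[]]] := hstd.
have gap0 : \sum_t \sum_x (cost v t x - cost u t x) = 0.
  by apply/le_anti; rewrite gap_le0 sumr_ge0 // => t _; exact: sumr_ge0.
move=> t x; rewrite tight; congr (- _)%:E; apply/esym/eqP.
have gap_t := psumr_eq0P (fun t _ => sumr_ge0 _ (fun x _ => gap_ge0 t x)) gap0.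
have := psumr_eq0P (fun x _ => gap_ge0 t x) (gap_t t isT).
by move=> /(_ x isT) /eqP; rewrite subr_eq0.
Qed.

End complementarity.

End optimality.

(** * Solutions of the primal and dual problems *)

Section solutions.
Variables (R : realType) (T n : nat) (d : mfg_data R T n).
Variables (hstd : standing_assumption d) (hqual : qualification d).

(** The infimum is not [+oo] by the qualification at a null perturbation, which
    forces the constraint. *)
Lemma primal_solution_feasible c : primal_solution d c ->
  [/\ calA d c = target d, calF d c \is a fin_num &
    forall c', calA d c' = target d -> (calF d c <= calF d c')%E].
Proof.
move=> [_ c_min].
have obj_feasible c' : calA d c' = target d -> primal_obj d c' = calF d c'.
  by rewrite /primal_obj /calG => ->; rewrite eqxx adde0.
have min_le c' : (primal_obj d c <= primal_obj d c')%E.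
  by rewrite c_min; apply: ereal_inf_lbound; exists c'.
have [s _ [c0 c0y c0A]] := qualification_direction hstd hqual 0.
rewrite scaler0 addr0 in c0A.
have obj_lty : (primal_obj d c < +oo)%E.
  by apply: le_lt_trans (min_le c0) _; rewrite obj_feasible.
have cA : calA d c = target d.
  move: obj_lty; rewrite /primal_obj /calG; case: eqP => // _.
  by rewrite addey ?ltxx // calF_neqNy.
split => // [|c' c'A]; last by rewrite -!obj_feasible.
by rewrite fin_numElt ltNye calF_neqNy // -obj_feasible.
Qed.

Lemma dotK_calAD (c e : Cspace R T n) k :
  dotK (calA d (c + e)) k =
  dotK (calA d c) k + dotC e (calA_adj_formula d k).
Proof.
rewrite !calA_adj_formulaP; case: (calA_adj_formula d k) => [[[m' w'] m2'] D'].
case: c e => [[[m w] m2] D] [[[dm dw] dm2] dD] /=.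
have -> : dot_kern (w + dw) w' = dot_kern w w' + dot_kern dw w'.
  by rewrite /dot_kern -big_split; apply: eq_bigr => t _ /=; rewrite -dotDl.
by rewrite !dotDl; ring.
Qed.

Lemma optimal_subgradient m w m2 D k :
  primal_solution d (m, w, m2, D) -> dual_solution d k ->
  forall dm dw dm2 dD,
  (calF d (m, w, m2, D) <= calF d (m + dm, w + dw, m2 + dm2, D + dD)%R +
    (dotC (dm, dw, dm2, dD) (calA_adj_formula d k))%:E)%E.
Proof.
move=> /primal_solution_feasible[cA cfin c_min] k_min dm dw dm2 dD.
have c_minE c' : calA d c' = target d ->
    ((fine (calF d (m, w, m2, D)))%:E <= calF d c')%E.
  by move=> c'A; rewrite fineK //; exact: c_min.
have := dual_solution_lagrangian hstd hqual c_minE k_min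
  ((m, w, m2, D) + (dm, dw, dm2, dD)).
by rewrite fineK // dotKB dotK_calAD cA [dotK _ _ + _]addrC addrK.
Qed.
End solutions.

Lemma argminP (R : realType) (X : Type) (A : set X) (f : X -> \bar R) x :
  A x -> (forall y, A y -> (f x <= f y)%E) -> argmin A f x.
Proof.
move=> Ax fx; split=> //; apply/le_anti/andP; split.
  by apply: le_ereal_inf_tmp => _ [y Ay <-]; exact: fx.
by apply: ereal_inf_lbound; exists x.
Qed.

Theorem proposition5p3 (R : realType) (T n : nat) (hT : (0 < T)%N) (hn : (0 < n)%N)
    (d : mfg_data R T n)
    (hstd : standing_assumption d) (hqual : qualification d)
    (m1 : 'M[R]_(T.+1, n)) (w : 'I_T -> 'M[R]_n) (m2 : 'M[R]_(T.+1, n))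
    (D : 'rV[R]_T)
    (u gamma : 'M[R]_(T.+1, n)) (P : 'rV[R]_T)
    (hprimal : primal_solution d (m1, w, m2, D))
    (hdual : dual_solution d (u, gamma, P))
    (uhat : 'M[R]_(T.+1, n)) (huhat : uhat = opU d gamma P)
    (pi : 'I_T -> 'M[R]_n) (hpi : policies d m1 w uhat P pi) :
  mfg_system d m1 pi uhat gamma P.
Proof.
have [cA cfin _] := primal_solution_feasible hstd hqual hprimal.
have sub := optimal_subgradient hstd hqual hprimal hdual.
have hhjb : hjb d gamma P uhat by rewrite huhat; exact: opU_hjb.
have [_ hjb_T] := hhjb.
have [fin1 _ _] := calF_parts_fin cfin.
have uT := terminal_condition cfin sub.
have [flow_eq m12 DE] := cA.
have {m12} m12 : m2 = m1 by apply/esym/eqP; rewrite -subr_eq0 m12.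
have {DE} DE : D = opA d w by apply/esym/eqP; rewrite -subr_eq0 DE.
have m_init x : m1 ord0 x = mfg_m0 d ord0 x.
  have := congr1 (fun M : 'M[R]_(T.+1, n) => M ord0 x) flow_eq.
  by rewrite !mxE unlift_none eqxx; lra.
have m_next (t : 'I_T) x : m1 (tnext t) x = \sum_y w t y x.
  have := congr1 (fun M : 'M[R]_(T.+1, n) => M (tnext t) x) flow_eq.
  by rewrite !mxE liftK /=; lra.
have tight := tight_transfer hstd m_init m_next uT hjb_T (hjb_feasible hstd hhjb)
  (feasible_le_hjb hstd (subgradient_feasible cfin sub) uT hhjb)
  (mass_term_edge_cost cfin sub).
have [pi_pol pi_opt] := hpi.
(* A finite perspective rules out negative mass and flow out of an empty state. *)
have supp t x : 0 < m1 (tnow t) x \/ m1 (tnow t) x = 0 /\ row x (w t) = 0.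
  have := fin1 t x; rewrite /perspective; case: ltP => [|_]; first by left.
  by case: ifP => // /andP[/eqP-> /eqP->]; right.
have w_pi t x y : w t x y = m1 (tnow t) x * pi t x y.
  have [m_gt0|[m_eq0 w_eq0]] := supp t x.
    have /rowP/(_ y) := (pi_opt t x).1 m_gt0; rewrite !mxE => ->.
    by rewrite mulVKf // lt0r_neq0.
  by have /rowP/(_ y) := w_eq0; rewrite !mxE m_eq0 mul0r.
have pi_min t x : argmin (@simplex R n)
    (fun rho => bellman d uhat P t x rho + (gamma (tnow t) x)%:E)%E (row x (pi t)).
  apply: argminP => //= rho rhoS.
  have [m_gt0|[m_eq0 _]] := supp t x.
    apply: (le_trans _ (hjb_le hstd t x rho hhjb)); rewrite bellman_edge_cost.
    have w_row : row x (w t) = m1 (tnow t) x *: row x (pi t).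
      by apply/rowP => y; rewrite !mxE w_pi.
    have pZ := perspectiveZ (mfg_ell d t x) 1 (row x (pi t)) (ltW m_gt0).
    have cZ := edge_costZ d gamma P uhat t x (m1 (tnow t) x) 1 (row x (pi t)).
    have := tight t x; rewrite mulr1 in pZ cZ; rewrite w_row pZ cZ.
    rewrite /perspective ltr01 invr1 scale1r mul1e.
    case: (mfg_ell d t x _) => [r| |]; last 2 first.
    - by rewrite gt0_muley ?lte_fin.
    - by rewrite gt0_muleNy ?lte_fin.
    rewrite -EFinM -mulrN => -[] /(mulfI (lt0r_neq0 m_gt0)) ->.
    by rewrite -EFinD lee_fin; lra.
  apply: leeD => //; have [_ ->] := (pi_opt t x).2 m_eq0.
  by apply: ereal_inf_lbound; exists rho.
split.
- split=> // t x; exact (hjb_dynamic_programming hstd t x hhjb).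
- exact: pi_min.
- split=> // t x; rewrite m_next; apply: eq_bigr => y _; exact: w_pi.
- by move=> s; rewrite -m12; apply: (F_subgradient cfin sub).
- move=> t; have := phi_subgradient cfin sub t; rewrite DE mxE.
  congr (subdiff _ _ _ _).
  by apply: eq_bigr => x _; apply: eq_bigr => y _; rewrite w_pi.
Qed.
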